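(* Let $\{T_t\}_{t\ge 0}$ be a sub-Markovian semigroup on $B_b(\mathbb{R}^d)$ with representing kernels $P_t(x,\cdot)$. Then the following properties are equivalent: (a) $\{T_t\}_{t\ge 0}$ has the strong Feller property; (b) $\{T_t\}_{t\ge 0}$ has the $C_b$-Feller property and for every $t>0$ there exists some positive Radon measure $\mu_t$ on $\mathbb{R}^d$ such that the family of measures $(P_t(x,dy))_{x\in\mathbb{R}^d}$ is locally uniformly absolutely continuous with respect to $\mu_t$, i.e. for any compact set $K\subset\mathbb{R}^d$ $$\lim_{\delta\to 0}\;\sup_{A\in\mathcal{B}(\mathbb{R}^d),\,\mu_t(A)\le\delta}\;\sup_{z\in K}P_t(z,A)=0;$$ (c) $\{T_t\}_{t\ge 0}$ has the $C_b$-Feller property and for every $t>0$ there exists a probability measure $\mu_t$ on $\mathbb{R}^d$ such that the family of measures $(P_t(x,dy))_{x\in\mathbb{R}^d}$ is locally uniformly absolutely continuous with respect to $\mu_t$. If, in addition, the semigroup $\{T_t\}_{t\ge0}$ is such that for every $f\in C_c^\infty(\mathbb{R}^d)$, $T_tf$ converges locally uniformly to $f$ as $t\to 0$, then all statements above are also equivalent to (d) $\{T_t\}_{t\ge 0}$ has the $C_b$-Feller property and there exists a probability measure $\mu$ on $\mathbb{R}^d$ such that for every $t>0$ the family of measures $(P_t(x,dy))_{x\in\mathbb{R}^d}$ is locally uniformly absolutely continuous with respect to $\mu$.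
   Context: $B_b(\mathbb{R}^d)$ denotes the bounded Borel measurable functions on $\mathbb{R}^d$, $C_b(\mathbb{R}^d)$ the bounded continuous functions, $\mathcal{B}(\mathbb{R}^d)$ the Borel sets. A sub-Markovian semigroup on $B_b(\mathbb{R}^d)$ is the semigroup of operators $T_tf(x)=\int f(y)\,P_t(x,dy)$ ($T_0=\mathrm{id}$, $T_{s+t}=T_sT_t$) given by a transition function $P_t(x,dy)$ consisting of sub-probability kernels on $\mathbb{R}^d$; thus $T_t$ maps $B_b(\mathbb{R}^d)$ to itself, $0\le u\le 1$ implies $0\le T_tu\le 1$, and $P_t(x,A)=T_t\mathbf{1}_A(x)$. No strong continuity in $t$ is assumed. $C_b$-Feller property: $T_tf\in C_b(\mathbb{R}^d)$ for all $f\in C_b(\mathbb{R}^d)$ and all $t\ge0$. Strong Feller property: $T_tf\in C_b(\mathbb{R}^d)$ for all $f\in B_b(\mathbb{R}^d)$ and all $t>0$. The family $(P_t(x,dy))_{x\in\mathbb{R}^d}$ is locally uniformly absolutely continuous with respect to a measure $\mu$ if for every compact $K\subset\mathbb{R}^d$, $\lim_{\delta\to0}\sup_{A\in\mathcal{B}(\mathbb{R}^d),\,\mu(A)\le\delta}\sup_{z\in K}P_t(z,A)=0$. *)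

(* Defs.v *)
From HB Require Import structures.
From mathcomp Require Export all_boot all_order all_algebra.
From mathcomp Require Export all_classical all_reals all_analysis.

Set Implicit Arguments.
Unset Strict Implicit.
Unset Printing Implicit Defensive.

Export Order.TTheory GRing.Theory Num.Theory.
Export numFieldNormedType.Exports.

Local Open Scope classical_set_scope.
Local Open Scope ring_scope.

(* R^d is 'rV[R]_d with its normed-space topology. Rd_borel R d has the same
   carrier, equipped with the Borel sigma-algebra: the library puts no
   measurable structure on matrices. *)
Notation Rd_borel R d := (g_sigma_algebraType (@open 'rV[R]_d)).

Section function_spaces.
Context {R : realType} {d : nat}.
Implicit Type f : 'rV[R]_d -> R.

Definition Bb : set ('rV[R]_d -> R) :=
  [set f | measurable_fun [set: Rd_borel R d] (f : Rd_borel R d -> R) /\ bounded_fun f].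

Definition Cb : set ('rV[R]_d -> R) :=
  [set f | continuous f /\ bounded_fun f].

Definition partial_derivative (i : 'I_d) f : 'rV[R]_d -> R :=
  fun x => 'D_(delta_mx 0 i) f x.

(* mixed partial derivative of order size s; the last index of s is
   differentiated first *)
Definition iterated_partial (s : seq 'I_d) f : 'rV[R]_d -> R :=
  foldr partial_derivative f s.

(* The existence clause is needed because 'D_v is total. *)
Definition smooth f :=
  forall s : seq 'I_d, continuous (iterated_partial s f) /\
    forall (i : 'I_d) (x : 'rV[R]_d),
      derivable (iterated_partial s f) x (delta_mx 0 i).

Definition Cc_infty : set ('rV[R]_d -> R) :=
  [set f | smooth f /\ compact (closure [set x | f x != 0])].

End function_spaces.

Section semigroups.
Context {R : realType} {d : nat}.

(* Only the values at times t >= 0 of a family P indexed by R are relevant. *)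
Implicit Type P : R -> R.-spker (Rd_borel R d) ~> (Rd_borel R d).

Definition semigroup_op P (t : R) (f : 'rV[R]_d -> R) : 'rV[R]_d -> R :=
  fun x => \int[P t x]_y f y.

Definition sub_Markovian_semigroup P :=
  (forall f, Bb f -> semigroup_op P 0 f = f) /\
  (forall s t f, 0 <= s -> 0 <= t -> Bb f ->
    semigroup_op P (s + t) f = semigroup_op P s (semigroup_op P t f)).

Definition Cb_Feller P :=
  forall t f, 0 <= t -> Cb f -> Cb (semigroup_op P t f).

Definition strong_Feller P :=
  forall t f, 0 < t -> Bb f -> Cb (semigroup_op P t f).

Definition Radon_measure (mu : {measure set (Rd_borel R d) -> \bar R}) :=
  (forall K : set 'rV[R]_d, compact K -> (mu K < +oo)%E) /\
  (forall A : set (Rd_borel R d), measurable A ->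
    mu A = ereal_sup [set mu K | K in
      [set K : set 'rV[R]_d | compact K /\ K `<=` A]]).

(* K is taken nonempty because ereal_sup set0 = -oo, whereas the supremum of
   the empty family of values of P_t is understood to be 0. *)
Definition locally_uniformly_ac
    (k : R.-spker (Rd_borel R d) ~> (Rd_borel R d))
    (mu : {measure set (Rd_borel R d) -> \bar R}) :=
  forall K : set 'rV[R]_d, compact K -> K !=set0 ->
    ereal_sup [set ereal_sup [set k z A | z in K] | A in
      [set A : set (Rd_borel R d) | measurable A /\ (mu A <= delta%:E)%E]]
      @[delta --> 0^'+] --> 0%E.

Definition locally_uniformly_continuous_at_0 P :=
  forall f, Cc_infty f ->
    {family compact, semigroup_op P t f @[t --> 0^'+] --> f}.

End semigroups.

(* Main.v *)
From mathcomp Require Import ring lra measurable_realfun.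
Require Import Defs.

Set Implicit Arguments.
Unset Strict Implicit.
Unset Printing Implicit Defensive.

Local Open Scope classical_set_scope.
Local Open Scope ring_scope.

(* For (a) => (d), sum the measures P_{1/i}(x_j, .) over i and a dense sequence
   x_j with summable weights and normalize to mu. If mu(A) = 0 then
   T_{1/i} 1_A vanishes at every x_j, hence everywhere by continuity, and
   T_t 1_A = T_{t-1/i} T_{1/i} 1_A = 0 for t > 1/i. If sum_n mu(A_n) < oo, then
   the sets U_{j >= n} A_j decrease to a mu-null set, so by Dini's theorem
   the continuous functions P_t(., U_{j >= n} A_j) tend to 0 uniformly on
   compact sets, which rules out a failure of local uniform absolute continuity.

   For (b) => (a), Dini's theorem applied to cutoff functions gives tightness of
   P_t(z, .) uniformly for z in a compact K, so that P_t(z, A_n) -> 0 uniformly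
   on K whenever A_n decreases to the empty set. By Egorov's argument, continuity
   of T_t f is then stable under bounded pointwise limits of f, and a monotone
   class argument extends it from C_b to B_b. *)

(** * Boundedness, Dini's theorem and convergence to zero *)

Lemma bounded_funP (R : realFieldType) (X : Type) (f : X -> R) :
  bounded_fun f <-> exists M, forall x, `|f x| <= M.
Proof.
split=> [[M [_ fM]]|[M fM]].
  by exists (M + 1) => x; apply: fM => //; rewrite ltrDl.
by exists M; split=> [|N MN x _]; [exact: num_real|exact: le_trans (ltW MN)].
Qed.

(** Near each point one function [f N] lies below [e] by continuity, and monotonicity passes this to
    all later n; the near-covering form of compactness makes the index uniform on [K]. *)
Lemma Dini_decreasing (R : realType) (X : topologicalType) (f : nat -> X -> R)
    (K : set X) (e : R) :
  compact K -> 0 < e -> (forall n, continuous (f n)) ->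
  (forall x, nonincreasing_seq (f^~ x)) -> (forall x, f^~ x @ \oo --> (0 : R)) ->
  \forall n \near \oo, forall x, K x -> f n x < e.
Proof.
move=> /compact_near_coveringP cK e0 cf nif f0.
apply: (cK _ _ (fun n x => f n x < e)) => x Kx.
have /cvgr_lt /(_ _ e0) [N _ /(_ N (leqnn N)) fN] := f0 x.
have nx : \forall x' \near x, f N x' < e by apply: (cvgr_lt (f N x)) => //; exact: cf.
exists ([set x' | f N x' < e], [set n | (N <= n)%N]).
  by split=> //; exists N.
by move=> [x' n] /= [fx' Nn]; apply: le_lt_trans fx'; exact: nif.
Qed.

Lemma near_ge0_cvge0P (R : realType) (I : Type) (F : set_system I) (g : I -> \bar R) :
  Filter F -> (\forall i \near F, (0 <= g i)%E) ->
  g @ F --> 0%E <-> forall e : R, 0 < e -> \forall i \near F, (g i <= e%:E)%E.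
Proof.
move=> FF g0; split=> [h e e0|h].
  have e0' : (0 < e%:E)%E by rewrite lte_fin.
  have h1 : \forall i \near F, (g i < e%:E)%E := h _ (open_ereal_lt' e0').
  by apply: filterS h1 => i /ltW.
have g_fin e i : (0 <= g i)%E -> (g i <= e%:E)%E -> g i \is a fin_num.
  by move=> gi0 gie; rewrite ge0_fin_numE//; exact: le_lt_trans gie (ltry e).
apply/fine_cvgP; split; first by apply: filterS2 g0 (h 1 ltr01) => i; exact: g_fin.
apply/cvgr0Pnorm_le => e e0; apply: filterS2 g0 (h e e0) => i gi0 gie /=.
by rewrite ger0_norm ?fine_ge0// -lee_fin fineK//; exact: g_fin gie.
Qed.

Lemma continuous_distP (R : realFieldType) (X : topologicalType) (f : X -> R) :
  continuous f <->
  forall x e, 0 < e -> \forall x' \near x, `|f x - f x'| <= e.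
Proof.
split=> [cf x|cf x]; last by apply/cvgrPdist_le; exact: cf.
by apply/cvgrPdist_le; exact: cf.
Qed.

Lemma continuous_linear (R : realType) (X : topologicalType) (a b : R) (f g : X -> R) :
  continuous f -> continuous g -> continuous (fun x => a * (f x + b * g x)).
Proof.
move=> cf cg x; apply: cvgMr; apply: cvgD; first exact: cf.
by apply: cvgMr; exact: cg.
Qed.

(** * Borel functions on R^d and integration against one sub-probability kernel *)

Section kernels.
Context {R : realType} {d : nat}.
Local Notation T := 'rV[R]_d.
Local Notation B := (Rd_borel R d).
Implicit Types (f g : T -> R) (k : R.-spker B ~> B) (mu : {measure set B -> \bar R}).

Lemma closed_norm_le (r : R) : closed [set y : T | `|y| <= r].
Proof.
apply: (@preimage_closed _ _ _ [set r' : R | r' <= r]); last exact: closed_le.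
by move=> y _; exact: norm_continuous.
Qed.

Lemma compact_norm_le (r : R) : compact [set y : T | `|y| <= r].
Proof.
apply: bounded_closed_compact; last exact: closed_norm_le.
by exists r; split=> [|M rM y /= yr]; [exact: num_real|exact: le_trans yr (ltW rM)].
Qed.

Lemma open_Borel (U : set T) : open U -> measurable (U : set B).
Proof. by move=> oU; exact: sub_gen_smallest. Qed.

Lemma closed_Borel (F : set T) : closed F -> measurable (F : set B).
Proof.
by move=> cF; rewrite -[F]setCK; apply: measurableC; apply: open_Borel; rewrite openC.
Qed.

Lemma continuous_Borel f : continuous f -> measurable_fun [set: B] (f : B -> R).
Proof.
move=> /continuousP cf; apply: (measurability _ (RGenOpens.measurableE R)).
move=> _ [_ [a [b ->] <-]]; rewrite setTI; apply: open_Borel.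
exact/cf/interval_open.
Qed.

Lemma Cb_Bb : @Cb R d `<=` Bb.
Proof. by move=> f [cf bf]; split=> //; exact: continuous_Borel. Qed.

Lemma Bb_indic (A : set B) : measurable A -> @Bb R d (\1_A).
Proof.
move=> mA; split; first exact: measurable_indic.
apply/bounded_funP; exists 1 => x.
by rewrite indicE; case: (x \in A); rewrite ?normr1 ?normr0.
Qed.

Lemma spker_fin_num k x (A : set B) : measurable A -> k x A \is a fin_num.
Proof.
move=> mA; rewrite ge0_fin_numE//; apply: le_lt_trans (ltry 1).
by apply: le_trans (sprob_kernel_le1 k x); rewrite le_measure ?inE.
Qed.

(** [semigroup_op P t] unfolds to [kernel_op (P t)]; time is fixed until the semigroup law
    enters. *)
Definition kernel_op k f : T -> R := fun x => \int[k x]_y f y.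

Lemma Bb_integrable k x f : Bb f -> (k x).-integrable setT (EFin \o f).
Proof.
move=> [mf bf]; apply: measurable_bounded_integrable => //.
by rewrite -ge0_fin_numE// spker_fin_num.
Qed.

Lemma kernel_op_indic k x (A : set B) : measurable A ->
  kernel_op k \1_A x = fine (k x A).
Proof. by move=> mA; rewrite /kernel_op /Rintegral integral_indic// setIT. Qed.

Lemma kernel_op_bounded k f : Bb f -> bounded_fun (kernel_op k f).
Proof.
move=> Bf; have [_ /bounded_funP[M fM]] := Bf; apply/bounded_funP; exists M => x.
have M0 : 0 <= M by apply: le_trans (fM 0).
apply: (le_trans (le_normr_Rintegral _ (Bb_integrable k x Bf))) => //.
have Bcst : Bb (cst M : T -> R).
  split; first exact: measurable_cst.
  by apply/bounded_funP; exists M => y; rewrite ger0_norm.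
have Bnf : Bb (fun y => `|f y|).
  case: Bf => mf _; split; first exact: measurableT_comp.
  by apply/bounded_funP; exists M => y; rewrite normr_id.
apply: (@le_trans _ _ (\int[k x]_y (cst M y))).
  by apply: le_Rintegral => //; [exact: Bb_integrable Bnf|exact: Bb_integrable Bcst].
rewrite Rintegral_cst// ler_piMr//.
by rewrite -lee_fin fineK ?spker_fin_num//; exact: sprob_kernel_le1.
Qed.

(** * Local uniform absolute continuity in epsilon-delta form, and its derivation from null sets *)

Lemma locally_uniformly_acP k mu :
  locally_uniformly_ac k mu <->
  forall K : set T, compact K -> forall e : R, 0 < e ->
    exists2 dl : R, 0 < dl & forall A : set B, measurable A ->
      (mu A <= dl%:E)%E -> forall z, K z -> (k z A <= e%:E)%E.
Proof.
pose g (K : set T) (dl : R) : \bar R := ereal_sup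
  [set ereal_sup [set k z A | z in K] | A in
    [set A : set B | measurable A /\ (mu A <= dl%:E)%E]].
have g_ub K dl A z : measurable A -> (mu A <= dl%:E)%E -> K z -> (k z A <= g K dl)%E.
  move=> mA Adl Kz; apply: le_ereal_sup_tmp.
  exists (ereal_sup [set k z A | z in K]); first by exists A.
  by apply: ereal_sup_ubound; exists z.
split=> [h K cK e e0|h K cK [z0 Kz0]].
  have [K0|K0] := pselect (K !=set0); last first.
    by exists 1 => // A _ _ z Kz; exfalso; apply: K0; exists z.
  have e0' : (0 < e%:E)%E by rewrite lte_fin.
  have gK : \forall dl \near 0^'+, (g K dl < e%:E)%E := h K cK K0 _ (open_ereal_lt' e0').
  near (0 : R)^'+ => dl.
  exists dl => // A mA Adl z Kz.
  apply: le_trans (g_ub _ _ _ _ mA Adl Kz) _.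
  by apply: ltW; near: dl.
apply/near_ge0_cvge0P => [|e e0].
  (* The empty set is always admissible, so its value at [z0] keeps the supremum nonnegative. *)
  near=> dl; apply: (@le_trans _ _ (k z0 set0)) => //.
  by apply: (g_ub K) => //; rewrite measure0 lee_fin.
have [dl dl0 kdl] := h K cK e e0.
near=> dl'; apply: ge_ereal_sup => _ [A [mA Adl] <-].
apply: ge_ereal_sup => _ [z Kz <-]; apply: kdl => //.
apply: le_trans Adl _; rewrite lee_fin; near: dl'; exact: nbhs_right_le.
Unshelve. all: by end_near. Qed.

(** Borel-Cantelli and Dini, by contradiction: sets that violate uniformity have a null limsup,
    along whose tails the kernel must nevertheless vanish uniformly on [K]. *)
Lemma locally_uniformly_ac_null k mu :
  (mu setT < +oo)%E ->
  (forall A : set B, measurable A -> continuous (kernel_op k \1_A)) ->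
  (forall A : set B, measurable A -> mu A = 0%E -> forall x, k x A = 0%E) ->
  locally_uniformly_ac k mu.
Proof.
move=> mufin ck k0; apply/locally_uniformly_acP => K cK e e0.
apply: contrapT => /forall2NP nex.
(* The bounds 2^-(n+1) sum to 1, which makes the series of masses finite for Borel-Cantelli. *)
have /choice[A hA] n : exists A : set B, [/\ measurable A,
    (mu A <= (1 / (2 ^ n.+1)%:R)%:E)%E & exists2 z, K z & (e%:E < k z A)%E].
  have [|/existsNP[A /not_implyP[mA /not_implyP[muA /existsNP[z /not_implyP[Kz kz]]]]]] :=
    nex (1 / (2 ^ n.+1)%:R).
    by case; rewrite divr_gt0// ltr0n expn_gt0.
  exists A; split=> //; exists z => //.
  by rewrite ltNge; apply/negP.
have mA n : measurable (A n) by have [] := hA n.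
have limA0 : mu (lim_sup_set A) = 0%E.
  apply: lim_sup_set_cvg0 => //; apply: (@le_lt_trans _ _ 1%:E) (ltry _).
  apply: le_trans (epsilon_trick0 xpredT (@ler01 R)).
  by apply: lee_nneseries => // n _; have [] := hA n.
pose C n := \bigcup_(j >= n) A j.
have mC n : measurable (C n) by apply: bigcup_measurable => j _.
have mlim : measurable (lim_sup_set A) by apply: bigcapT_measurable.
have : \forall n \near \oo, forall x, K x -> kernel_op k \1_(C n) x < e.
  apply: Dini_decreasing => //.
  - by move=> n; exact: ck.
  - move=> x m n mn; rewrite !kernel_op_indic// fine_le ?spker_fin_num//.
    rewrite le_measure ?inE// => y [j /= nj Aj].
    by exists j => //=; exact: leq_trans nj.
  - move=> x; under eq_fun do rewrite kernel_op_indic//.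
    have -> : (0 : R) = fine (k x (lim_sup_set A)) by rewrite k0.
    apply: fine_cvg; rewrite fineK ?spker_fin_num//.
    apply: lim_sup_set_cvg => //.
    by rewrite -ge0_fin_numE// spker_fin_num//; exact: mC.
move=> [N _ /(_ N (leqnn N)) CN].
(* The witness of [A N] charges [A N], hence the larger tail [C N], by more than [e]. *)
have [_ _ [z Kz]] := hA N; apply/negP; rewrite -leNgt.
have := CN z Kz; rewrite kernel_op_indic// -lte_fin fineK ?spker_fin_num//.
move=> /ltW; apply: le_trans; rewrite le_measure ?inE//.
by move=> y Ay; exists N => /=.
Qed.

(** * Tightness and uniform continuity from above at the empty set *)

(** This makes the continuity at the empty set of the measures [k z] uniform for z in a compact set.
    It is the form in which absolute continuity enters Egorov's argument, with no reference measure
    left. *)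
Definition locally_uniformly_vanishing k :=
  forall K : set T, compact K -> forall A : (set B)^nat,
    (forall n, measurable (A n)) -> nonincreasing_seq A -> \bigcap_n A n = set0 ->
  forall e : R, 0 < e -> \forall n \near \oo, forall z, K z -> (k z (A n) <= e%:E)%E.

Lemma le_kernel_op k f g x : Bb f -> Bb g -> (forall y, f y <= g y) ->
  kernel_op k f x <= kernel_op k g x.
Proof.
move=> Bf Bg fg; apply: le_Rintegral => //.
  exact: (Bb_integrable k x Bf).
exact: (Bb_integrable k x Bg).
Qed.

(** Since [mu] may be infinite, [mu (A n)] need not tend to 0. Tightness first discards the part
    outside a large ball; inside, [mu] is finite and continuity from above applies. *)
Lemma locally_uniformly_ac_vanishing k mu :
  (forall K : set T, compact K -> (mu K < +oo)%E) ->
  (forall f, Cb f -> continuous (kernel_op k f)) ->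
  locally_uniformly_ac k mu -> locally_uniformly_vanishing k.
Proof.
move=> muK ck /locally_uniformly_acP ac K cK A mA niA capA e e0.
(* A continuous cutoff, 0 for |y| at most n and 1 for |y| at least n+1, hence between the indicators
   of [G n.+1] and [G n]. The Feller property makes its image continuous, as Dini requires. *)
pose chi n (y : T) : R := Num.max 0 (Num.min 1 (`|y| - n%:R)).
pose G n : set T := [set y | n%:R <= `|y|].
have mG n : measurable (G n : set B).
  apply: closed_Borel; apply: (@preimage_closed _ _ _ [set r : R | n%:R <= r]).
    by move=> y _; exact: norm_continuous.
  exact: closed_ge.
have chi_cont n : continuous (chi n).
  move=> y; apply: (@continuous_max _ _ (cst 0) (cst 1 \min (fun y => `|y| - n%:R))).
    exact: cst_continuous.
  apply: continuous_min; first exact: cst_continuous.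
  by apply: continuousB; [exact: norm_continuous|exact: cst_continuous].
have chi0 n y : 0 <= chi n y by rewrite le_max lexx.
have chi1 n y : chi n y <= 1 by rewrite ge_max ler01 ge_min lexx.
have chiCb n : Cb (chi n).
  split; first exact: chi_cont.
  by apply/bounded_funP; exists 1 => y; rewrite ger0_norm.
have chi_ge n x : fine (k x (G n.+1)) <= kernel_op k (chi n) x.
  rewrite -kernel_op_indic//; apply: le_kernel_op.
  - exact: Bb_indic.
  - exact/Cb_Bb.
  - move=> y; rewrite indicE; have [|_] := boolP (y \in G n.+1); last exact: chi0.
    by rewrite inE /G /= => Gy; rewrite /chi le_max le_min lexx lerBrDl natr1 Gy orbT.
have chi_le n x : kernel_op k (chi n) x <= fine (k x (G n)).
  rewrite -kernel_op_indic//; apply: le_kernel_op.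
  - exact/Cb_Bb.
  - exact: Bb_indic.
  - move=> y; rewrite indicE; have [_|] := boolP (y \in G n); first exact: chi1.
    rewrite notin_setE /G /= => /negP; rewrite -ltNge => Gy.
    by rewrite ge_max lexx/= ge_min subr_le0 (ltW Gy) orbT.
have niG : nonincreasing_seq G.
  by move=> m n mn; apply/subsetPset => y /=; apply: le_trans; rewrite ler_nat.
have capG : \bigcap_n G n = set0.
  rewrite -subset0 => y Gy; have := Gy (Num.truncn `|y|).+1 I.
  by rewrite /G /= leNgt truncnS_gt.
have G0 x : fine (k x (G n)) @[n --> \oo] --> (0 : R).
  have -> : (0 : R) = fine (k x (\bigcap_n G n)) by rewrite capG measure0.
  apply: fine_cvg; rewrite fineK ?spker_fin_num//; last by rewrite capG.
  apply: nonincreasing_cvg_mu => //; last by rewrite capG.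
  by rewrite -ge0_fin_numE// spker_fin_num.
have e20 : 0 < e / 2 by rewrite divr_gt0.
have : \forall n \near \oo, forall x, K x -> kernel_op k (chi n) x < e / 2.
  apply: Dini_decreasing => //.
  - by move=> n; exact: ck.
  - move=> x m n mn; apply: le_kernel_op; [exact/Cb_Bb|exact/Cb_Bb|].
    move=> y; rewrite /chi le_max2// le_min2// lerB// ler_nat//.
  - move=> x; apply: squeeze_cvgr (G0 x); last exact: cvg_cst.
    near=> n; rewrite chi_le andbT; apply: le_trans (chi_ge _ _).
    exact: fine_ge0.
move=> [N _ /(_ N (leqnn N)) chiN].
have [dl dl0 kdl] := ac K cK (e / 2) e20.
(* The radius is N+1 because [chi N] dominates the indicator of [G N.+1], not that of [G N]. *)
pose A' n := A n `&` ~` G N.+1.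
have mA' n : measurable (A' n : set B) by apply: measurableI => //; exact: measurableC.
have cap0 : \bigcap_n A' n = set0.
  by rewrite -subset0 -capA => y A'y n _; have [] := A'y n I.
have : mu (A' n) @[n --> \oo] --> 0%E.
  rewrite -(measure0 mu) -cap0; apply: nonincreasing_cvg_mu => //.
  - apply: le_lt_trans (muK _ (@compact_norm_le N.+1%:R)).
    rewrite le_measure ?inE//; first by apply: closed_Borel; exact: closed_norm_le.
    by move=> y [_ /= /negP]; rewrite /G /= -ltNge => /ltW.
  - by rewrite cap0.
  - move=> m n mn; apply/subsetPset; apply: setSI; exact/subsetPset/niA.
move=> /near_ge0_cvge0P-/(_ _ dl dl0) A'dl.
near=> n => z Kz.
apply: (@le_trans _ _ (k z (A' n) + k z (G N.+1))%E).
  apply: le_trans (measureU2 _ _ _) => //; rewrite le_measure ?inE//.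
    exact: measurableU.
  by move=> y Ay; have [Gy|Gy] := pselect (G N.+1 y); [right|left].
rewrite (splitr e) EFinD leeD//.
  by apply: kdl => //; near: n; apply: A'dl; near=> m.
rewrite -[k z _]fineK ?spker_fin_num// lee_fin.
exact: le_trans (chi_ge _ _) (ltW (chiN z Kz)).
Unshelve. all: by end_near. Qed.

(** * Linearity, and continuity under bounded pointwise limits *)

Lemma kernel_opD k f g x : Bb f -> Bb g ->
  kernel_op k (fun y => f y + g y) x = kernel_op k f x + kernel_op k g x.
Proof.
move=> Bf Bg; apply: RintegralD => //.
  exact: (Bb_integrable k x Bf).
exact: (Bb_integrable k x Bg).
Qed.

Lemma kernel_opZ k c f x : Bb f ->
  kernel_op k (fun y => c * f y) x = c * kernel_op k f x.
Proof. by move=> Bf; apply: RintegralZl => //; exact: (Bb_integrable k x Bf). Qed.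

Lemma Bb_bounded f M : measurable_fun [set: B] (f : B -> R) ->
  (forall y, `|f y| <= M) -> Bb f.
Proof. by move=> mf fM; split=> //; apply/bounded_funP; exists M. Qed.

Lemma Bb_cst c : Bb (cst c : T -> R).
Proof. by apply: (@Bb_bounded _ `|c|) => //; exact: measurable_cst. Qed.

Lemma BbD f g : Bb f -> Bb g -> Bb (fun y => f y + g y).
Proof.
move=> [mf /bounded_funP[M fM]] [mg /bounded_funP[N gN]].
apply: (@Bb_bounded _ (M + N)); first exact: measurable_funD.
by move=> y; apply: le_trans (ler_normD _ _) _; exact: lerD.
Qed.

Lemma BbZ c f : Bb f -> Bb (fun y => c * f y).
Proof.
move=> [mf /bounded_funP[M fM]]; apply: (@Bb_bounded _ (`|c| * M)).
  by apply: measurable_funM => //; exact: measurable_cst.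
by move=> y; rewrite normrM ler_wpM2l.
Qed.

(** Integrate the pointwise bound; as [k x] has mass at most 1, the constant [e] contributes at most
    [e]. *)
Lemma kernel_op_dist_le k f g (A : set B) x e M : Bb f -> Bb g -> measurable A ->
  0 <= e -> (forall y, `|f y - g y| <= e + M * \1_A y) ->
  `|kernel_op k f x - kernel_op k g x| <= e + M * fine (k x A).
Proof.
move=> Bf Bg mA e0 fg.
have BD : Bb (fun y => f y + -1 * g y) by apply: BbD => //; exact: BbZ.
have -> : kernel_op k f x - kernel_op k g x = kernel_op k (fun y => f y + -1 * g y) x.
  by rewrite kernel_opD ?kernel_opZ ?mulN1r//; exact: BbZ.
have Bn : Bb (fun y => `|f y + -1 * g y|).
  have [mD /bounded_funP[N DN]] := BD; apply: (@Bb_bounded _ N).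
    exact: measurableT_comp.
  by move=> y; rewrite normr_id.
apply: le_trans (le_normr_Rintegral _ (Bb_integrable k x BD)) _ => //.
apply: (@le_trans _ _ (kernel_op k (fun y => cst e y + M * \1_A y) x)).
  apply: (le_kernel_op k x Bn); last by move=> y; rewrite mulN1r.
  by apply: BbD; [exact: Bb_cst|apply: BbZ; exact: Bb_indic].
rewrite kernel_opD ?kernel_opZ ?kernel_op_indic//; last 3 first.
- exact: Bb_indic.
- exact: Bb_cst.
- by apply: BbZ; exact: Bb_indic.
rewrite lerD2r /kernel_op Rintegral_cst// ler_piMr//.
by rewrite -lee_fin fineK ?spker_fin_num//; exact: sprob_kernel_le1.
Qed.

(* Egorov's argument: outside the sets E n, which decrease to set0, f_ n is
   uniformly close to f. *)
Lemma kernel_op_continuous_lim k (f_ : nat -> T -> R) f M :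
  locally_uniformly_vanishing k ->
  (forall n, measurable_fun [set: B] (f_ n : B -> R)) ->
  (forall n y, `|f_ n y| <= M) -> (forall y, f_ n y @[n --> \oo] --> f y) ->
  (forall n, continuous (kernel_op k (f_ n))) -> continuous (kernel_op k f).
Proof.
move=> vk mf_ f_M f_f cf_.
have mf : measurable_fun [set: B] (f : B -> R).
  by apply: (measurable_fun_cvg mf_) => y _; exact: f_f.
have fM y : `|f y| <= M.
  have nf : `|f_ n y| @[n --> \oo] --> `|f y| by apply: cvg_norm; exact: f_f.
  by apply: (cvgr_to_le nf); apply: nearW => n; exact: f_M.
have Bf : Bb f := Bb_bounded mf fM.
have Bf_ n : Bb (f_ n) := Bb_bounded (mf_ n) (f_M n).
have unif K e : compact K -> 0 < e ->
    exists n, forall z, K z -> `|kernel_op k (f_ n) z - kernel_op k f z| <= e.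
  (* [N] is a bound at least [M] and strictly positive, so that it can be divided by. On the
     exceptional set the functions differ by at most 2N, and mass e/(4N) there costs e/2. *)
  move=> cK e0; pose N := `|M| + 1; have N0 : 0 < N by rewrite ltr_wpDl.
  pose D n : set B := [set y | e / 2 < `|f_ n y - f y|].
  have mD n : measurable (D n).
    have mlt : measurable_fun [set: B] (fun y : B => e / 2 < `|f_ n y - f y|).
      apply: measurable_fun_ltr; first exact: measurable_cst.
      by apply: measurableT_comp => //; exact: measurable_funB.
    by rewrite -[D n]setTI; exact: (mlt measurableT [set true]).
  pose E n : set B := \bigcup_(j >= n) D j.
  have mE n : measurable (E n) by apply: bigcup_measurable.
  have : \forall n \near \oo, forall z, K z -> (k z (E n) <= (e / (4 * N))%:E)%E.
    apply: vk => //; last by rewrite divr_gt0// mulr_gt0.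
      move=> m n mn; apply/subsetPset => y [j /= nj Dj].
      by exists j => //=; exact: leq_trans nj.
    (* A point of every [E n] would lie in infinitely many [D j], against convergence at y. *)
    rewrite -subset0 => y Ey.
    have /cvgrPdist_le/(_ (e / 2)) [|n _ fn] := f_f y; first by rewrite divr_gt0.
    have [j /= nj] := Ey n I; rewrite /D /= distrC.
    by have := fn j nj; rewrite leNgt => /negP.
  move=> [n _ /(_ n (leqnn n)) En]; exists n => z Kz.
  apply: le_trans (@kernel_op_dist_le _ _ _ (E n) _ (e / 2) (2 * N) _ _ _ _ _) _ => //.
  - by rewrite divr_ge0// ltW.
  - move=> y; rewrite indicE; have [_|] := boolP (y \in E n).
      rewrite mulr1; apply: le_trans (ler_normB _ _) _.
      apply: (@le_trans _ _ (N + N)); last by rewrite -mulr2n mulr_natl lerDr divr_ge0// ltW.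
      have MN : M <= N by rewrite (le_trans (ler_norm M))// lerDl.
      by apply: lerD; [exact: le_trans (f_M _ _) MN|exact: le_trans (fM _) MN].
    rewrite notin_setE mulr0 addr0 => nE; rewrite leNgt; apply/negP => fD.
    by apply: nE; exists n => /=.
  - have : fine (k z (E n)) <= e / (4 * N).
      by rewrite -lee_fin fineK ?spker_fin_num//; exact: En.
    rewrite -(ler_pM2l (x := 2 * N)) ?mulr_gt0// => h; apply: le_trans (lerD (lexx _) h) _.
    have -> : 2 * N * (e / (4 * N)) = e / 2 by field; rewrite gt_eqF.
    by rewrite -splitr.
apply/continuous_distP => x e e0.
have e30 : 0 < e / 3 by rewrite divr_gt0.
(* The closed ball of radius |x|+1 about the origin is a compact neighbourhood of x, on which the
   uniform estimate holds for x and all nearby points; three errors of e/3 follow. *)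
have [n fn] := unif _ _ (@compact_norm_le (`|x| + 1)) e30.
have cn := (continuous_distP _).1 (cf_ n) x (e / 3) e30.
near=> x'.
rewrite (_ : kernel_op k f x - _ = - (kernel_op k (f_ n) x - kernel_op k f x) +
  (kernel_op k (f_ n) x - kernel_op k (f_ n) x') +
  (kernel_op k (f_ n) x' - kernel_op k f x')); last by ring.
rewrite (_ : e = e / 3 + e / 3 + e / 3); last by field.
apply: le_trans (ler_normD _ _) _; apply: lerD.
  apply: le_trans (ler_normD _ _) _; apply: lerD.
    by rewrite normrN; apply: fn => /=; rewrite lerDl.
  by near: x'.
apply: fn => /=.
near: x'; apply: (cvgr_le `|x|); first exact: norm_continuous.
by rewrite ltrDl.
Unshelve. all: by end_near. Qed.

(** * Extension from continuous functions to open sets, Borel sets and bounded Borel functions *)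

(** For open [U] these closed sets increase to [U], each at a uniform distance from the complement.
    They serve both Urysohn separation and the regularity of open sets. *)
Definition ball_core (U : set T) n : set T := [set x | ball x n.+1%:R^-1 `<=` U].

Lemma closed_ball_core U n : closed (ball_core U n).
Proof.
rewrite -openC openE => x /= /existsNP[y /not_implyP[xy nUy]].
(* Being near x is replaced by lying in the open ball about y: by symmetry each such z has y in its
   own ball, so it is outside the core. *)
have /nbhs_ballP[e e0 xe] : nbhs x (ball y n.+1%:R^-1).
  rewrite nbhsE /=; exists (ball y n.+1%:R^-1) => //.
  split; last exact: ball_sym.
  exact: ball_open.
apply/nbhs_ballP; exists e => // z /xe yz /= cU.
by apply: nUy; apply: cU; exact: ball_sym.
Qed.

Lemma ball_core_sub U n : ball_core U n `<=` U.
Proof. by move=> x; apply; exact: ballxx. Qed.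

Lemma bigcup_ball_core U : open U -> \bigcup_n ball_core U n = U.
Proof.
move=> oU; apply/seteqP; split=> [x [n _ /ball_core_sub]//|x Ux].
have /nbhs_ballP[e e0 xe] : nbhs x U by exact: open_nbhs_nbhs.
exists (Num.truncn e^-1) => // y xy; apply: xe; apply: le_ball xy.
by rewrite invf_ple ?posrE// ltW// truncnS_gt.
Qed.

Lemma nondecreasing_ball_core U : nondecreasing_seq (ball_core U).
Proof.
move=> m n mn; apply/subsetPset => x xU y xy; apply: xU; apply: le_ball xy.
by rewrite lef_pV2 ?posrE// ler_nat.
Qed.

(** Urysohn functions that are 0 off [U] and 1 on [ball_core U n] converge boundedly to the
    indicator of [U], being eventually constant in n at every point. *)
Lemma kernel_op_open_continuous k (U : set T) :
  locally_uniformly_vanishing k -> (forall f, Cb f -> continuous (kernel_op k f)) ->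
  open U -> continuous (kernel_op k \1_U).
Proof.
move=> vk ck oU.
pose u n : T -> R := Urysohn (~` U) (ball_core U n).
have sep n : uniform_separator (~` U) (ball_core U n).
  apply: uniform_separatorW; exists [set xy | ball xy.1 n.+1%:R^-1 xy.2].
    by rewrite -entourage_ballE; exists n.+1%:R^-1 => /=.
  rewrite -subset0 => -[x y] /= [[nUx cUy] /ball_sym xy].
  exact/nUx/cUy.
have u01 n x : 0 <= u n x <= 1.
  have := @Urysohn_range _ R (~` U) (ball_core U n) (u n x).
  by rewrite /= in_itv/=; apply; exists x.
have u_norm n x : `|u n x| <= 1 by have /andP[? ?] := u01 n x; rewrite ger0_norm.
have cu n : continuous (u n) by exact: Urysohn_continuous.
apply: (@kernel_op_continuous_lim _ u _ 1) => //.
- by move=> n; exact: continuous_Borel.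
- move=> x; rewrite indicE; have [|] := boolP (x \in U).
    rewrite inE => Ux; have [N _ cN] : (\bigcup_n ball_core U n) x by rewrite bigcup_ball_core.
    apply: cvg_near_cst; exists N => // n /= Nn.
    apply: (Urysohn_sub1 (sep n)); exists x => //.
    by have /subsetPset := @nondecreasing_ball_core U _ _ Nn; apply.
  rewrite notin_setE => nUx; apply: cvg_near_cst; apply: nearW => n.
  by apply: (Urysohn_sub0 (sep n)); exists x.
- move=> n; apply: ck; split; first exact: cu.
  by apply/bounded_funP; exists 1.
Qed.

(** Dynkin's pi-lambda theorem with the open sets as pi-system. Complements are subtracted from the
    whole space, and disjoint unions are bounded limits of finite ones. *)
Lemma kernel_op_indic_continuous k (A : set B) :
  locally_uniformly_vanishing k -> (forall f, Cb f -> continuous (kernel_op k f)) ->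
  measurable A -> continuous (kernel_op k \1_A).
Proof.
move=> vk ck mA.
have copen (U : set T) := @kernel_op_open_continuous k U vk ck.
pose P (A : set B) := continuous (kernel_op k \1_A).
refine (@dynkin_induction _ B (@open T) P erefl _ _ _ _ _ A mA).
- by move=> U V oU oV; exact: openI.
- by apply: copen; exact: openT.
- exact: copen.
- move=> S mS cS; rewrite /P.
  have -> : kernel_op k \1_(~` S) =
      fun x => kernel_op k \1_[set: T] x - kernel_op k \1_S x.
    apply/funext => x; rewrite !kernel_op_indic//; last exact: measurableC.
    rewrite -(setvU S) measureU//; last 2 first.
    - exact: measurableC.
    - by rewrite setICl.
    by rewrite fineD ?spker_fin_num// ?addrK//; exact: measurableC.
  move=> x; apply: continuousB; last exact: cS.
  by apply: copen; exact: openT.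
- move=> F mF tF cF.
  have mb n : measurable (\big[setU/set0]_(i < n) F i) by exact: bigsetU_measurable.
  apply: (@kernel_op_continuous_lim _ (fun n => \1_(\big[setU/set0]_(i < n) F i)) _ 1) => //.
  + by move=> n y; rewrite indicE; case: (y \in _); rewrite ?normr1 ?normr0.
  + move=> y; rewrite indicE; have [|] := boolP (y \in _).
      rewrite inE => -[N _ FN]; apply: cvg_near_cst; exists N.+1 => // n /= Nn.
      rewrite indicE mem_set//; rewrite -bigcup_mkord; exists N => //.
    rewrite notin_setE => nF; apply: cvg_near_cst; apply: nearW => n.
    rewrite indicE memNset// -bigcup_mkord => -[i _ Fi].
    by apply: nF; exists i.
  + move=> n; have -> : kernel_op k \1_(\big[setU/set0]_(i < n) F i) =
        fun x => \sum_(i < n) kernel_op k \1_(F i) x.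
      apply/funext => x; rewrite kernel_op_indic// measure_bigsetU//.
      rewrite -sum_fine; last by move=> i _; exact: spker_fin_num.
      by apply: eq_bigr => i _; rewrite kernel_op_indic.
    by apply: continuous_big => [|i _]; [exact: add_continuous|exact: cF].
Qed.

(** Binary expansion of f/c: the indicator of {f > c/2} is the first digit, the remainder 2f - c 1_A
    again has values in [0, c], and each further digit halves the error. *)
Lemma kernel_op_approx k f c n :
  (forall A : set B, measurable A -> continuous (kernel_op k \1_A)) ->
  measurable_fun [set: B] (f : B -> R) -> (forall y, 0 <= f y <= c) ->
  exists g, [/\ Bb g, continuous (kernel_op k g) & forall y, `|f y - g y| <= c * 2^-1 ^+ n].
Proof.
move=> ck; elim: n f => [|n IHn] f mf f0c.
  exists (cst 0); split; first exact: Bb_cst.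
    have -> : kernel_op k (cst 0) = cst 0.
      by apply/funext => x; rewrite /kernel_op Rintegral_cst// mul0r.
    exact: cst_continuous.
  by move=> y; have /andP[f0 fc] := f0c y; rewrite subr0 expr0 mulr1 ger0_norm.
pose A : set B := [set y | c / 2 < f y].
have mA : measurable A.
  have mlt : measurable_fun [set: B] (fun y : B => c / 2 < f y).
    by apply: measurable_fun_ltr => //; exact: measurable_cst.
  by rewrite -[A]setTI; exact: (mlt measurableT [set true]).
have [|y|g [Bg cg fg]] := IHn (fun y => 2 * f y - c * \1_A y).
- by apply: measurable_funB; apply: measurable_funM.
- have /andP[f0 fc] := f0c y; rewrite indicE; have [|] := boolP (y \in A).
    rewrite inE /A /= => cf; apply/andP; split; lra.
  rewrite notin_setE /A /= => /negP; rewrite -leNgt => cf; apply/andP; split; lra.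
have BA : Bb (\1_A : T -> R) by exact: Bb_indic.
exists (fun y => 2^-1 * (g y + c * \1_A y)); split.
- by apply: BbZ; apply: BbD => //; exact: BbZ.
- have -> : kernel_op k (fun y => 2^-1 * (g y + c * \1_A y)) =
      fun x => 2^-1 * (kernel_op k g x + c * kernel_op k \1_A x).
    apply/funext => x; rewrite kernel_opZ ?kernel_opD ?kernel_opZ//; first exact: BbZ.
    by apply: BbD => //; exact: BbZ.
  by apply: continuous_linear => //; exact: ck.
- move=> y; rewrite (_ : f y - _ = 2^-1 * (2 * f y - c * \1_A y - g y)); last by field.
  rewrite normrM ger0_norm// exprS mulrCA ler_pM2l//.
Qed.

Lemma vanishing_kernel_op_continuous k f :
  locally_uniformly_vanishing k -> (forall f, Cb f -> continuous (kernel_op k f)) ->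
  Bb f -> continuous (kernel_op k f).
Proof.
move=> vk ck Bf; have [mf /bounded_funP[M fM]] := Bf.
have M0 : 0 <= M by apply: le_trans (fM 0).
have cA (A : set B) := @kernel_op_indic_continuous k A vk ck.
(* The shift puts the values in [0, 2M]. It is undone by a constant function, whose image is
   continuous by the Feller property. *)
pose h y := f y + M.
have mh : measurable_fun [set: B] (h : B -> R).
  by apply: measurable_funD => //; exact: measurable_cst.
have h0 y : 0 <= h y <= 2 * M.
  by have := fM y; rewrite ler_norml /h => /andP[? ?]; apply/andP; split; lra.
have /choice[g hg] n := @kernel_op_approx k h (2 * M) n cA mh h0.
suff ch : continuous (kernel_op k h).
  have -> : kernel_op k f = fun x => kernel_op k h x + kernel_op k (cst (- M)) x.
    apply/funext => x; rewrite -kernel_opD; last exact: Bb_cst.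
      by congr (kernel_op k _ x); apply/funext => y; rewrite /h addrK.
    by apply: BbD => //; exact: Bb_cst.
  move=> x; apply: continuousD; first exact: ch.
  apply: ck; split; first exact: cst_continuous.
  by have [] := Bb_cst (- M).
have cvg0 : 2 * M * 2^-1 ^+ n @[n --> \oo] --> (0 : R).
  by apply: cvg_geometric; rewrite ger0_norm// invf_lt1// ltr1n.
(* The bound is 2M for [h] plus an approximation error of at most 2M. *)
apply: (@kernel_op_continuous_lim _ g _ (4 * M)) => //.
- by move=> n; have [[]] := hg n.
- move=> n y; have [_ _ /(_ y)] := hg n.
  have : 2 * M * 2^-1 ^+ n <= 2 * M.
    by rewrite ler_piMr// ?mulr_ge0// exprn_ile1// invf_le1// ler1n.
  have /andP[] := h0 y; rewrite !ler_norml => ? ? ? /andP[? ?]; apply/andP; split; lra.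
- move=> y; apply/cvgrPdist_le => e e0.
  have /cvgr_le/(_ e e0) := cvg0; apply: filterS => n; apply: le_trans.
  by have [] := hg n.
- by move=> n; have [] := hg n.
Qed.

End kernels.

(** * Regularity of finite Borel measures on R^d *)

Section regularity.
Context {R : realType} {d : nat}.
Local Notation T := 'rV[R]_d.
Local Notation B := (Rd_borel R d).
Context (mu : {measure set B -> \bar R}) (mu_fin : (mu setT < +oo)%E).

Lemma finite_measure_lty (A : set B) : measurable A -> (mu A < +oo)%E.
Proof. by move=> mA; apply: le_lt_trans mu_fin; rewrite le_measure ?inE. Qed.

Lemma near_finite_measure_le (D : (set B)^nat) (e : R) :
  (forall n, measurable (D n)) -> nonincreasing_seq D ->
  (mu (\bigcap_n D n) < e%:E)%E -> \forall n \near \oo, (mu (D n) <= e%:E)%E.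
Proof.
move=> mD niD De.
have cD : mu (D n) @[n --> \oo] --> mu (\bigcap_n D n).
  apply: nonincreasing_cvg_mu => //; first exact: (finite_measure_lty (mD 0%N)).
  exact: bigcapT_measurable.
have h : \forall n \near \oo, (mu (D n) < e%:E)%E := cD _ (open_ereal_lt' De).
by apply: filterS h => n /ltW.
Qed.

(** Inner approximation by closed sets and outer approximation by open sets are joined in one
    condition so that complements merely exchange them. *)
Definition sandwiched (A : set T) := forall e : R, 0 < e ->
  exists F U : set T, [/\ closed F, open U, F `<=` A, A `<=` U &
    (mu (U `\` F) <= e%:E)%E].

Lemma open_sandwiched (U : set T) : open U -> sandwiched U.
Proof.
move=> oU e e0.
have mUC n : measurable (U `\` ball_core U n : set B).
  by apply: measurableD; [exact: open_Borel|apply: closed_Borel; exact: closed_ball_core].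
have [||N _ /(_ N (leqnn N)) UN] := @near_finite_measure_le (fun n => U `\` ball_core U n) e mUC.
- by move=> m n mn; apply/subsetPset; apply: setDS; exact/subsetPset/nondecreasing_ball_core.
- rewrite (_ : \bigcap_n _ = set0) ?measure0 ?lte_fin// -subset0 => x Ux.
  have [Ux0 _] := Ux 0%N I.
  have [n _ Cn] : (\bigcup_n ball_core U n) x by rewrite bigcup_ball_core.
  by have [_] := Ux n I.
exists (ball_core U N), U; split => //; [exact: closed_ball_core|exact: ball_core_sub].
Qed.

Lemma sandwichedC (A : set T) : sandwiched A -> sandwiched (~` A).
Proof.
move=> rA e /rA[F [U [cF oU FA AU UF]]]; exists (~` U), (~` F).
split; [by rewrite closedC|by rewrite openC|exact: subsetC|exact: subsetC|].
by rewrite setDE setCK setIC -setDE.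
Qed.

(** The open envelopes may all be united, but only finitely many of the closed sets; continuity from
    above bounds the loss from truncation. *)
Lemma sandwiched_bigcup (A : (set T)^nat) :
  (forall n, sandwiched (A n)) -> sandwiched (\bigcup_n A n).
Proof.
move=> rA e e0.
have e20 : 0 < e / 2 by rewrite divr_gt0.
have /choice[FU hFU] n : exists FU : set T * set T, [/\ closed FU.1, open FU.2,
    FU.1 `<=` A n, A n `<=` FU.2 & (mu (FU.2 `\` FU.1) <= (e / 2 / (2 ^ n.+1)%:R)%:E)%E].
  have [|F [U ?]] := rA n (e / 2 / (2 ^ n.+1)%:R); last by exists (F, U).
  by rewrite divr_gt0// ltr0n expn_gt0.
pose F n := (FU n).1; pose U n := (FU n).2.
have mF n : measurable (F n : set B) by apply: closed_Borel; have [] := hFU n.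
have mU n : measurable (U n : set B) by apply: open_Borel; have [] := hFU n.
pose V : set T := \bigcup_n U n; pose G n : set T := \big[setU/set0]_(i < n) F i.
have mV : measurable (V : set B) by exact: bigcup_measurable.
have mG n : measurable (G n : set B) by exact: bigsetU_measurable.
have [|||N _ /(_ N (leqnn N)) VN] := @near_finite_measure_le (fun n => V `\` G n) e.
- by move=> n; exact: measurableD.
- move=> m n mn; apply/subsetPset; apply: setDS.
  exact: subset_bigsetU.
(* The errors total e/2, leaving the strict gap below [e] that the truncation needs. *)
- apply: (@le_lt_trans _ _ (e / 2)%:E); last first.
    by rewrite lte_fin ltr_pdivrMr// ltr_pMr// ltr1n.
  apply: (@le_trans _ _ (mu (\bigcup_n (U n `\` F n)))).
    rewrite le_measure ?inE//.
    + by apply: bigcapT_measurable => n; exact: measurableD.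
    + by apply: bigcup_measurable => n _; exact: measurableD.
    + move=> x VG; have [[n _ Un] _] := VG 0%N I; exists n => //; split=> // Fn.
      have [_] := VG n.+1 I; apply; rewrite /G -bigcup_mkord.
      by exists n => //=.
  apply: (@le_trans _ _ (\sum_(0 <= n <oo) mu (U n `\` F n))%E).
    apply: measure_sigma_subadditive => //.
    + by move=> n; exact: measurableD.
    + by apply: bigcup_measurable => n _; exact: measurableD.
  apply: le_trans (epsilon_trick0 xpredT (ltW e20)).
  by apply: lee_nneseries => // n _; have [] := hFU n.
exists (G N), V; split => //.
- by apply: closed_bigsetU => i _; have [] := hFU i.
- by apply: bigcup_open => i _; have [] := hFU i.
- rewrite /G -bigcup_mkord => x [n _ Fn]; exists n => //.
  by have [_ _ + _ _] := hFU n; apply.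
- move=> x [n _ An]; exists n => //.
  by have [_ _ _ + _] := hFU n; apply.
Qed.

Lemma measurable_sandwiched (A : set B) : measurable A -> sandwiched A.
Proof.
apply: (@smallest_sub _ (sigma_algebra setT) (@open T) sandwiched).
  split.
  - exact/open_sandwiched/open0.
  - by move=> S; rewrite setTD; exact: sandwichedC.
  - exact: sandwiched_bigcup.
exact: open_sandwiched.
Qed.

(** A closed inner approximation becomes compact after intersection with a large closed ball, whose
    complement has small mass because [mu] is finite. *)
Lemma finite_measure_Radon : Radon_measure mu.
Proof.
have mK (K : set T) : compact K -> measurable (K : set B).
  by move=> /(compact_closed (@norm_hausdorff R 'rV[R]_d)); exact: closed_Borel.
split=> [K cK|A mA]; first exact: (finite_measure_lty (mK K cK)).
apply/eqP; rewrite eq_le; apply/andP; split; last first.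
  apply: ge_ereal_sup => _ [K [cK KA] <-]; rewrite le_measure ?inE//.
  exact: mK.
apply/lee_addgt0Pr => e e0.
have e20 : 0 < e / 2 by rewrite divr_gt0.
have [F [U [cF oU FA AU UF]]] := measurable_sandwiched mA e20.
pose b n : set T := [set y : T | `|y| <= n%:R].
have mb n : measurable (b n : set B) by apply: closed_Borel; exact: closed_norm_le.
have [|||N _ /(_ N (leqnn N)) bN] := @near_finite_measure_le (fun n => ~` b n) (e / 2).
- by move=> n; exact: measurableC.
- move=> m n mn; apply/subsetPset; apply: subsetC => y /= /le_trans; apply.
  by rewrite ler_nat.
- rewrite (_ : \bigcap_n _ = set0) ?measure0 ?lte_fin// -subset0 => x bx.
  by have := bx (Num.truncn `|x|).+1 I; apply; rewrite /b /= ltW// truncnS_gt.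
have cK : compact (F `&` b N).
  by rewrite setIC; apply: compact_closedI => //; exact: compact_norm_le.
have mFU : measurable (U `\` F : set B).
  by apply: measurableD; [exact: open_Borel|exact: closed_Borel].
apply: (@le_trans _ _ (mu (F `&` b N) + (mu (U `\` F) + mu (~` b N)))%E).
  apply: (@le_trans _ _ (mu ((F `&` b N) `|` ((U `\` F) `|` ~` b N)))).
    rewrite le_measure ?inE//.
      apply: measurableU; first exact: mK.
      by apply: measurableU => //; exact: measurableC.
    move=> x Ax; have [Fx|nFx] := pselect (F x); last by right; left; split => //; exact: AU.
    by have [bx|nbx] := pselect (b N x); [left|right; right].
  apply: le_trans (measureU2 _ _ _) _; first exact: mK.
    by apply: measurableU => //; exact: measurableC.
  by rewrite leeD2l// measureU2//; exact: measurableC.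
apply: leeD.
  by apply: ereal_sup_ubound; exists (F `&` b N) => //; split=> // x [/FA].
by rewrite (splitr e) EFinD; exact: leeD.
Qed.

End regularity.

(** * A dense sequence and a probability dominating countably many measures *)

Lemma rV_dense_seq (R : realType) d : exists q : nat -> 'rV[R]_d,
  forall U : set 'rV[R]_d, open U -> U !=set0 -> exists n, U (q n).
Proof.
(* Rows of rationals, enumerated by their codes; integers that code no row give 0. *)
exists (fun n => map_mx ratr (odflt 0 (unpickle n : option 'rV[rat]_d))) => U oU [x Ux].
have /nbhs_ballP[e e0 xe] : nbhs x U by exact: open_nbhs_nbhs.
have /choice[r hr] i : exists r : rat, ball (x ord0 i) e (ratr r).
  have [r] := @rat_in_itvoo _ (x ord0 i) (x ord0 i + e) (ltr_pwDr e0 (lexx _)).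
  rewrite in_itv/= => /andP[xr re]; exists r.
  rewrite /ball /= distrC gtr0_norm ?subr_gt0//.
  by rewrite ltrBlDl.
exists (pickle (\row_i r i : 'rV[rat]_d)); rewrite pickleK /=; apply: xe.
by split=> // i j; rewrite !mxE ord1; exact: hr.
Qed.

(** [mnormalize] falls back on [Q] when the mass is 0 or infinite: in the first case every set is
    null already, and finiteness excludes the second. *)
Lemma null_mnormalize d (X : measurableType d) (R : realType)
    (m : {measure set X -> \bar R}) (Q : probability X R) (A : set X) :
  measurable A -> (m setT < +oo)%E -> mnormalize m Q A = 0%E -> m A = 0%E.
Proof.
move=> mA mfin; rewrite /mnormalize.
case: ifPn => [/orP[/eqP m0 _|/eqP moo]|].
- by apply/eqP; rewrite eq_le measure_ge0 andbT -m0 le_measure ?inE.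
- by move: mfin; rewrite moo ltxx.
- rewrite negb_or => /andP[m0 _] /eqP; rewrite mule_eq0 => /orP[/eqP//|].
  rewrite eqe invr_eq0 fine_eq0; first by rewrite (negbTE m0).
  by rewrite ge0_fin_numE.
Qed.

Lemma countable_dominating_probability d (X : measurableType d) (R : realType)
    (Q : nat -> {measure set X -> \bar R}) (x0 : X) :
  (forall n, (Q n setT <= 1)%E) ->
  exists mu : probability X R, forall A, measurable A -> mu A = 0%E ->
    forall n, Q n A = 0%E.
Proof.
move=> Q1.
have c0 n : 0 <= (1 / (2 ^ n.+1)%:R : R) by rewrite divr_ge0.
pose nu n : {measure set X -> \bar R} := mscale (NngNum (c0 n)) (Q n).
pose m : {measure set X -> \bar R} := mseries nu 0.
have mfin : (m setT < +oo)%E.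
  apply: (@le_lt_trans _ _ 1%:E) (ltry _).
  apply: le_trans (epsilon_trick0 xpredT (@ler01 R)).
  apply: lee_nneseries => // n _.
  by rewrite /nu /= /mscale /= -[leRHS]mule1 lee_wpmul2l// lee_fin.
(* The Dirac mass is the default value if all the [Q n] vanish. *)
exists (mnormalize m (dirac x0)) => A mA /(null_mnormalize mA mfin) mA0 n.
have : (nu n A <= 0)%E.
  rewrite -mA0; apply: (@le_trans _ _ (\sum_(0 <= i < n.+1) nu i A)%E).
    by rewrite big_nat_recr//= leeDr// sume_ge0.
  exact: nneseries_lim_ge.
rewrite /nu /= /mscale /= => nuA; apply/eqP; rewrite eq_le measure_ge0 andbT.
by rewrite -(@pmule_rle0 _ (1 / (2 ^ n.+1)%:R)%:E)// lte_fin divr_gt0// ltr0n expn_gt0.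
Qed.

(** * Implications between the Feller properties and absolute continuity *)

Section semigroup.
Context {R : realType} {d : nat}.
Local Notation T := 'rV[R]_d.
Local Notation B := (Rd_borel R d).
Context (P : R -> R.-spker B ~> B) (hP : sub_Markovian_semigroup P).

Lemma strong_Feller_Cb_Feller : strong_Feller P -> Cb_Feller P.
Proof.
move=> sf t f; rewrite le_eqVlt => /predU1P[<-|t0] Cf.
  by rewrite hP.1//; exact: Cb_Bb.
by apply: sf => //; exact: Cb_Bb.
Qed.

Lemma locally_uniformly_ac_strong_Feller : Cb_Feller P ->
  (forall t, 0 < t -> exists mu : {measure set B -> \bar R},
    (forall K : set T, compact K -> (mu K < +oo)%E) /\ locally_uniformly_ac (P t) mu) ->
  strong_Feller P.
Proof.
move=> cP acP t f t0 Bf; have [mu [muK ac]] := acP t t0.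
have ck g : Cb g -> continuous (kernel_op (P t) g).
  by move=> Cg; have [] := cP t g (ltW t0) Cg.
split; last exact: (kernel_op_bounded (P t) Bf).
apply: (vanishing_kernel_op_continuous _ ck Bf).
exact: locally_uniformly_ac_vanishing muK ck ac.
Qed.

Lemma strong_Feller_locally_uniformly_ac : strong_Feller P ->
  exists mu : probability B R, forall t, 0 < t -> locally_uniformly_ac (P t) mu.
Proof.
move=> sf; have [q q_dense] := rV_dense_seq R d.
(* The index n codes a pair (i, j), which stands for the time 1/(i+1) and the point [q j]. *)
pose ij n : nat * nat := odflt (0%N, 0%N) (unpickle n).
have [|mu mu0] := @countable_dominating_probability _ B R
  (fun n => P (ij n).1.+1%:R^-1 (q (ij n).2)) (0 : T).
  by move=> n; exact: sprob_kernel_le1.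
have mufin : (mu setT < +oo)%E by rewrite probability_setT ltry.
exists mu => t t0; apply: locally_uniformly_ac_null; first exact: mufin.
- by move=> A mA; have [] := sf t _ t0 (Bb_indic mA).
move=> A mA muA x.
(* A time of the form 1/(i+1) below t, hence among those built into [mu]. *)
pose s : R := (Num.truncn t^-1).+1%:R^-1.
have s0 : 0 < s by rewrite invr_gt0.
have st : s < t by rewrite invf_plt ?posrE// truncnS_gt.
have BA := @Bb_indic R d A mA.
have Ts0 : semigroup_op P s \1_A = cst 0.
  apply/funext => z /=; apply: contrapT => /eqP Tz.
  have [cT _] := sf s _ s0 BA.
  (* If the continuous function were nonzero at z, it would be nonzero at some [q n], where nullity
     for [mu] forces the value 0. *)
  have [||n] := q_dense (semigroup_op P s \1_A @^-1` [set r | r != 0]).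
  - move/continuousP: cT; apply; exact: open_neq.
  - by exists z.
  apply/negP; rewrite negbK; apply/eqP.
  rewrite [LHS](kernel_op_indic (P s) (q n) mA).
  have := mu0 A mA muA (pickle (Num.truncn t^-1, n)).
  by rewrite /ij pickleK /= -/s => ->.
have Tt0 : kernel_op (P t) \1_A x = 0.
  rewrite -[LHS]/(semigroup_op P t \1_A x) -(subrK s t) hP.2 ?subr_ge0 ?ltW// Ts0.
  by rewrite /semigroup_op Rintegral_cst// mul0r.
move: Tt0; rewrite kernel_op_indic// => /eqP.
by rewrite fine_eq0 ?spker_fin_num// => /eqP.
Qed.

End semigroup.

(** * Equivalence of (a) to (d) through one cycle of implications *)

Theorem theorem2p1 (R : realType) (d : nat)
    (P : R -> R.-spker (Rd_borel R d) ~> (Rd_borel R d))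
    (hP : sub_Markovian_semigroup P) :
  let stmt_a := strong_Feller P in
  let stmt_b := Cb_Feller P /\ forall t : R, 0 < t ->
    exists mu : {measure set (Rd_borel R d) -> \bar R},
      Radon_measure mu /\ locally_uniformly_ac (P t) mu in
  let stmt_c := Cb_Feller P /\ forall t : R, 0 < t ->
    exists mu : probability (Rd_borel R d) R, locally_uniformly_ac (P t) mu in
  let stmt_d := Cb_Feller P /\
    exists mu : probability (Rd_borel R d) R, forall t : R, 0 < t ->
      locally_uniformly_ac (P t) mu in
  [<-> stmt_a; stmt_b; stmt_c] /\
  (locally_uniformly_continuous_at_0 P -> [<-> stmt_a; stmt_b; stmt_c; stmt_d]).
Proof.
move=> stmt_a stmt_b stmt_c stmt_d.
have prob_fin (mu : probability (Rd_borel R d) R) : (mu setT < +oo)%E.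
  by rewrite probability_setT ltry.
have ad : stmt_a -> stmt_d.
  move=> a; split; first exact: strong_Feller_Cb_Feller.
  exact: strong_Feller_locally_uniformly_ac.
have dc : stmt_d -> stmt_c.
  by move=> [cP [mu muP]]; split=> // t t0; exists mu; exact: muP.
have cb : stmt_c -> stmt_b.
  move=> [cP muP]; split=> // t /muP[mu ac]; exists mu; split=> //.
  exact/finite_measure_Radon/prob_fin.
have ba : stmt_b -> stmt_a.
  move=> [cP muP]; apply: locally_uniformly_ac_strong_Feller => // t /muP[mu [[muK _] ac]].
  by exists mu.
(* The cycle proved is (a), (d), (c), (b), (a); each implication in the listed order is a composite
   along it. *)
split=> [|_]; tfae.
- by move=> /ad/dc/cb.
- by move=> /ba/ad/dc.
- by move=> /cb/ba.
- by move=> /ad/dc/cb.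
- by move=> /ba/ad/dc.
- by move=> /cb/ba/ad.
- by move=> /dc/cb/ba.
Qed.
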